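(* Let $r$ and $n$ be integers with $r \geq n \geq 2$. If $M$ is a simple rank-$r$ binary matroid that is $\mathrm{PG}(n-1,2)$-free and satisfies $|M| > \left(1-\frac{3}{2^{n}}\right)2^{r}$, then there is a flat $K$ of $M$ of corank $n-2$ (i.e. $r(K) = r-(n-2)$) such that $M|K$ is triangle-free. Furthermore, $|K| > \frac{1}{4}2^{r(K)}$.
   Context: A matroid is $N$-free if it has no restriction isomorphic to $N$. A triangle is a matroid isomorphic to $\mathrm{PG}(1,2) \cong U_{2,3}$; a matroid is triangle-free if it is $\mathrm{PG}(1,2)$-free. $|M|$ denotes the size of the ground set of $M$, and $\mathrm{PG}(n-1,2)$ is the binary projective geometry of rank $n$. *)

(* Defs.v *)
From HB Require Import structures.
From mathcomp Require Import all_boot all_order all_algebra.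

Set Implicit Arguments.
Unset Strict Implicit.
Unset Printing Implicit Defensive.

Import GRing.Theory.

(* The ground set of a matroid is the whole finite type [E]; thus |M| is [#|E|]. *)
Record matroid (E : finType) := Matroid {
  indep : {set E} -> bool;
  indep_set0 : indep set0;
  indepS : forall A B : {set E}, A \subset B -> indep B -> indep A;
  indep_exchange : forall A B : {set E}, indep A -> indep B -> #|A| < #|B| ->
    exists2 x, x \in B :\: A & indep (x |: A)
}.

Definition isomorphic (E1 E2 : finType) (M : matroid E1) (N : matroid E2) : Prop :=
  exists f : E1 -> E2, bijective f /\ forall A : {set E1}, indep N (f @: A) = indep M A.

Section MatroidTheory.

Variables (E : finType) (M : matroid E).
Implicit Types (X K : {set E}) (e f : E).

Definition rank X : nat := \max_(A : {set E} | (A \subset X) && indep M A) #|A|.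

Definition matroid_rank : nat := rank [set: E].

Definition corank X : nat := matroid_rank - rank X.

Definition closure X : {set E} := [set e | rank (e |: X) == rank X].

Definition flat K : bool := closure K == K.

Definition loop e : bool := ~~ indep M [set e].

Definition parallel e f : bool :=
  [&& e != f, ~~ loop e, ~~ loop f & ~~ indep M [set e; f]].

Definition simple : Prop := (forall e, ~~ loop e) /\ (forall e f, ~~ parallel e f).

Section Restriction.

Variable X : {set E}.

Definition restrict_indep (A : {set {x : E | x \in X}}) : bool := indep M (val @: A).

Lemma restrict_set0 : restrict_indep set0.
Proof. by rewrite /restrict_indep imset0 indep_set0. Qed.

Lemma restrictS (A B : {set {x : E | x \in X}}) :
  A \subset B -> restrict_indep B -> restrict_indep A.
Proof. by move=> sAB; apply: indepS; apply: imsetS. Qed.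

Lemma restrict_exchange (A B : {set {x : E | x \in X}}) :
  restrict_indep A -> restrict_indep B -> #|A| < #|B| ->
  exists2 x, x \in B :\: A & restrict_indep (x |: A).
Proof.
move=> iA iB ltAB.
have [|y] := indep_exchange iA iB; first by rewrite !card_imset //; exact: val_inj.
rewrite inE => /andP[yA /imsetP[x xB def_y]]; rewrite {}def_y in yA * => ixA.
exists x; last by rewrite /restrict_indep imsetU1.
by rewrite inE xB andbT; apply: contra yA => xA; apply: imset_f.
Qed.

Definition restrict : matroid {x : E | x \in X} :=
  Matroid restrict_set0 restrictS restrict_exchange.

End Restriction.

End MatroidTheory.

Section VectorMatroid.

Variables (F : fieldType) (m : nat) (E : finType) (phi : E -> 'rV[F]_m).

(* [map] keeps repetitions, so distinct elements with equal vectors are dependent. *)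
Definition vector_indep (A : {set E}) : bool := free [seq phi x | x <- enum A].

Lemma vector_set0 : vector_indep set0.
Proof. by rewrite /vector_indep enum_set0 nil_free. Qed.

Lemma vectorS (A B : {set E}) : A \subset B -> vector_indep B -> vector_indep A.
Proof.
move=> sAB; rewrite /vector_indep => freeB.
have perB : perm_eq (enum B) (enum A ++ enum (B :\: A)).
  apply: uniq_perm; rewrite ?enum_uniq //.
    rewrite cat_uniq !enum_uniq andbT /=; apply/hasPn => x.
    by rewrite !mem_enum inE => /andP[].
  move=> x; rewrite mem_cat !mem_enum inE.
  by have [/(subsetP sAB)->|] := boolP (x \in A).
move: freeB; rewrite (perm_free (perm_map phi perB)) map_cat.
exact: catl_free.
Qed.

Lemma vector_exchange (A B : {set E}) :
  vector_indep A -> vector_indep B -> #|A| < #|B| ->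
  exists2 x, x \in B :\: A & vector_indep (x |: A).
Proof.
rewrite /vector_indep => freeA freeB ltAB.
have /allPn[_ /mapP[x xB ->] xA] :
    ~~ all (fun v => v \in <<[seq phi x | x <- enum A]>>%VS)
           [seq phi x | x <- enum B].
  apply: contraL ltAB => /allP sBA; rewrite -leqNgt.
  have /dimvS : (<<[seq phi x | x <- enum B]>> <=
      <<[seq phi x | x <- enum A]>>)%VS by apply/span_subvP.
  by rewrite (eqP freeA) (eqP freeB) !size_map -!cardE.
rewrite mem_enum in xB.
have xNA : x \notin A.
  by apply: contra xA => xA; apply/memv_span/map_f; rewrite mem_enum.
exists x; first by rewrite inE xNA.
have perA : perm_eq (enum (x |: A)) (x :: enum A).
  apply: uniq_perm; rewrite /= ?enum_uniq ?mem_enum ?xNA //.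
  by move=> y; rewrite !inE !mem_enum !inE.
by rewrite (perm_free (perm_map phi perA)) /= free_cons xA.
Qed.

Definition vector_matroid : matroid E :=
  Matroid vector_set0 vectorS vector_exchange.

End VectorMatroid.

Definition representable (F : fieldType) (E : finType) (M : matroid E) : Prop :=
  exists (m : nat) (phi : E -> 'rV[F]_m),
    forall A : {set E}, indep M A = indep (vector_matroid phi) A.

Definition binary (E : finType) (M : matroid E) : Prop := representable 'F_2 M.

(* [PG2 d] is PG(d, 2), of rank [d.+1]: over the two-element field each point     *)
(* (one-dimensional subspace) of the geometry has a unique nonzero vector.        *)
Definition PG2 (d : nat) : matroid {v : 'rV['F_2]_d.+1 | v != 0%R} :=
  vector_matroid (fun v => val v).

Definition matroid_free (E1 E2 : finType) (N : matroid E2) (M : matroid E1) : Prop :=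
  ~ exists X : {set E1}, isomorphic (restrict M X) N.

Definition triangle_free (E : finType) (M : matroid E) : Prop :=
  matroid_free (PG2 1) M.

(* Main.v *)
(* Represent M by a set S of nonzero vectors spanning a binary space V of dimension r, and let X
   be the complement of S in V. Then X contains 0, has fewer than 3 * 2 ^ (r - n) elements, and
   meets every n-dimensional subspace of V outside 0. It suffices, for n >= 3, to find a hyperplane
   H of V such that X meets every (n-1)-dimensional subspace of H outside 0: the size bound is
   inherited by H, and n - 2 such steps lead to the flat.

   Let U be an (n-1)-dimensional subspace with U \cap X = 0 (if there is none, any H will do).
   Every coset of U meets X. Choose W < U of codimension 2, and let Q run over the three subspaces
   strictly between W and U. Counting in each coset of U shows that the three sets X + Q have
   total size less than 2 |V|, so for one of them the complement L of X + Q has more than |V| / 3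
   elements. As X blocks n-dimensional subspaces, L is sum-free, and a sum-free set of density
   more than 1/3 lies in the complement of a hyperplane H: the cubes of its Fourier coefficients
   sum to 0, which gives a hyperplane whose complement has more than half of its points in L,
   and then L cannot have a point in the hyperplane itself. Now every coset of Q in H meets X, and
   if some (n-1)-dimensional subspace of H avoided X outside 0, all its cosets outside H would
   meet X; together this forces |X| >= 3 * 2 ^ (r - n). *)

From HB Require Import structures.
From Stdlib Require Import Classical_Prop.
Require Import Defs.
From mathcomp Require Import all_boot all_order all_algebra finfield zify ring.

Set Implicit Arguments.
Unset Strict Implicit.
Unset Printing Implicit Defensive.

Import Order.TTheory GRing.Theory Num.Theory.
Local Open Scope ring_scope.

(** * Arithmetic and lines in vector spaces over the two-element field *)

Lemma F2P (a : 'F_2) : a = 0 \/ a = 1.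
Proof. by case: a => [[|[|[]]] //= ?]; [left|right]; apply: val_inj. Qed.

Lemma addrr_F2 (T : lmodType 'F_2) (x : T) : x + x = 0.
Proof. by rewrite -mulr2n -scaler_nat (_ : 2%:R = 0) ?scale0r //; apply: val_inj. Qed.

Lemma oppr_F2 (T : lmodType 'F_2) (x : T) : - x = x.
Proof. by apply/eqP; rewrite eq_sym -addr_eq0 addrr_F2. Qed.

Lemma addKr_F2 (T : lmodType 'F_2) (x y : T) : x + (x + y) = y.
Proof. by rewrite addrA addrr_F2 add0r. Qed.

Lemma memv_add_line_F2 (T : vectType 'F_2) (U : {vspace T}) (u x : T) :
  (x \in U + <[u]>)%VS = (x \in U) || (x + u \in U).
Proof.
apply/memv_addP/orP => [[w wU [_ /vlineP[a ->] ->]]|].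
  case: (F2P a) => ->; rewrite ?scale0r ?addr0 ?scale1r; first by left.
  by right; rewrite -addrA addrr_F2 addr0.
case=> xU; first by exists x => //; exists 0; rewrite ?mem0v ?addr0.
by exists (x + u) => //; exists u; rewrite ?memv_line // -addrA addrr_F2 addr0.
Qed.

Lemma dim_add_line (F : fieldType) (T : vectType F) (U : {vspace T}) (u : T) :
  u \notin U -> \dim (U + <[u]>) = (\dim U).+1.
Proof.
move=> uU; rewrite dimv_disjoint_sum ?dim_vline; last first.
  apply/eqP; rewrite -subv0; apply/subvP => x; rewrite memv_cap memv0.
  case/andP => xU /vlineP[a xE]; apply: contraNT uU => x0.
  have a0 : a != 0 by apply: contraNneq x0 => a0; rewrite xE a0 scale0r.
  by rewrite -(scalerK a0 u) -xE memvZ.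
rewrite (_ : u != 0) ?addn1 //; apply: contraNneq uU => ->; exact: mem0v.
Qed.

(** * Characters, and the structure of dense sum-free sets *)

Section CharacterSums.
Variable m : nat.
Local Notation T := 'rV['F_2]_m.

Lemma card_subspace_F2 (V : {vspace T}) : #|[set x in V]| = (2 ^ \dim V)%N.
Proof. by rewrite cardsE card_vspace card_Fp. Qed.

Lemma card_hyperplane_compl (V H : {vspace T}) : (H <= V)%VS -> (\dim H).+1 = \dim V ->
  #|[set x in V] :\: [set x in H]| = (2 ^ \dim H)%N.
Proof.
move=> sHV dimH; rewrite cardsD (setIidPr _); last first.
  by apply/subsetP => x; rewrite !inE; exact: (subvP sHV).
by rewrite !card_subspace_F2 -dimH expnS mul2n -addnn addnK.
Qed.

(** The additive character attached to the dot product with [f]; its values are taken in [int], so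
    that character sums are integers. *)
Definition chi (f x : T) : int := if (f *m x^T) 0 0 == 0 then 1 else -1.

Lemma chiC f x : chi f x = chi x f.
Proof. by rewrite /chi -[f *m _]trmxK trmx_mul trmxK mxE. Qed.

Lemma chiD f x y : chi f (x + y) = chi f x * chi f y.
Proof.
rewrite /chi linearD mulmxDr mxE.
by case: (F2P ((f *m x^T) 0 0)) => ->; case: (F2P ((f *m y^T) 0 0)) => ->.
Qed.

Lemma chi0 f : chi f 0 = 1.
Proof. by rewrite /chi trmx0 mulmx0 mxE. Qed.

Lemma chiP f x : chi f x = 1 \/ chi f x = -1.
Proof. by rewrite /chi; case: ifP; [left|right]. Qed.

Lemma chi_neq1 f x : (chi f x != 1) = (chi f x == -1).
Proof. by case: (chiP f x) => ->. Qed.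

Lemma chi_nondegenerate x : x != 0 -> exists f, chi f x = -1.
Proof.
case/rV0Pn => j xj; exists (delta_mx 0 j).
rewrite /chi (_ : (_ *m _) 0 0 = x 0 j) ?(negPf xj) //.
by rewrite -rowE !mxE.
Qed.

(** If [chi f x0 = -1] for some [x0] in [V], translation by [x0] permutes [V] and negates the
    sum. *)
Lemma sum_chi (V : {vspace T}) f :
  \sum_(x in V) chi f x = if [forall x in V, chi f x == 1] then (2 ^ \dim V)%:R else 0.
Proof.
case: ifP => [/forall_inP h|/negbT].
  rewrite (eq_bigr (fun=> 1)) => [|x /h/eqP //].
  by rewrite sumr_const -card_subspace_F2 cardsE.
rewrite negb_forall_in => /exists_inP[x0 x0V]; rewrite chi_neq1 => /eqP fx0.
set s := \sum_(x in V) chi f x.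
have: s = - s.
  rewrite {1}/s (reindex_inj (addrI x0)) /= -sumrN; apply: eq_big => x.
    by rewrite rpredDl.
  by rewrite chiD fx0 mulN1r.
lia.
Qed.

Lemma sum_chi_dual x : \sum_f chi f x = if x == 0 then (2 ^ m)%:R else 0.
Proof.
have := sum_chi fullv x; rewrite (eq_bigl xpredT) => [|f]; last by rewrite memvf.
rewrite dimvf dim_matrix [(1 * m)%R]mul1n => h.
under eq_bigr do rewrite chiC; rewrite h; congr (if _ then _ else _).
apply/forall_inP/eqP => [h1|-> f _]; last by rewrite chiC chi0.
apply/eqP; apply/negPn/negP => /chi_nondegenerate[f fx].
by have := h1 f (memvf f); rewrite chiC fx.
Qed.

(** Double counting of [chi f x] over all [f] and all [x] in [V]: summing over [f] first leaves only
    [x = 0], summing over [x] first leaves only the [f] trivial on [V]. *)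
Lemma card_annihilator (V : {vspace T}) :
  (#|[set f : T | [forall x in V, chi f x == 1%R]]| * 2 ^ \dim V = 2 ^ m)%N.
Proof.
have: \sum_f \sum_(x in V) chi f x = (2 ^ m)%:R :> int.
  rewrite exchange_big /= (bigD1 0) ?mem0v //= sum_chi_dual eqxx big1 ?addr0 //.
  by move=> x /andP[_ /negPf x0]; rewrite sum_chi_dual x0.
under eq_bigr do rewrite sum_chi.
rewrite -big_mkcond sumr_const -mulrnA => /eqP; rewrite eqr_nat mulnC => /eqP <-.
by congr (_ * _)%N; apply: eq_card => f; rewrite !inE.
Qed.

(** Parseval: after expanding the square, only the diagonal pairs survive the sum over [f]. *)
Lemma sum_chi_square (L : {set T}) :
  \sum_f (\sum_(x in L) chi f x) ^+ 2 = (2 ^ m * #|L|)%:R.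
Proof.
under eq_bigr => f _ do rewrite expr2 big_distrlr /=.
rewrite exchange_big natrM mulr_natr -sumr_const /=; apply: eq_bigr => x xL.
rewrite exchange_big (bigD1 x) //= [X in _ + X]big1 => [|y /andP[_ yx]].
  under eq_bigr => f _ do rewrite -chiD.
  by rewrite addr0 sum_chi_dual addrr_F2 eqxx.
under eq_bigr => f _ do rewrite -chiD.
by rewrite sum_chi_dual addr_eq0 oppr_F2 eq_sym (negPf yx).
Qed.

(** A triple of points of [L] survives the sum over [f] only if its third point is the sum of the
    first two, which sum-freeness excludes. *)
Lemma sum_chi_cube (L : {set T}) : {in L &, forall x y, x + y \notin L} ->
  \sum_f (\sum_(x in L) chi f x) ^+ 3 = 0.
Proof.
move=> sumL; under eq_bigr => f _ do rewrite exprSr expr2 big_distrlr /= big_distrl /=.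
rewrite exchange_big big1 //= => x xL; under eq_bigr => f _ do rewrite big_distrlr /=.
rewrite exchange_big big1 //= => y yL; rewrite exchange_big big1 //= => z zL.
under eq_bigr => f _ do rewrite -!chiD.
rewrite sum_chi_dual addr_eq0 oppr_F2; case: eqP => // zE.
by have := sumL x y xL yL; rewrite zE zL.
Qed.

(* With s f the sum of [chi f] over [L], [2 * s f ^+ 3 + (2 ^ \dim V - 2 * #|L|) * s f ^+ 2] would
   be nonnegative for all nontrivial [f] if the lemma failed, but its sum is negative. *)
Lemma sum_free_biased_character (V : {vspace T}) (L : {set T}) :
  {subset L <= V} -> {in L &, forall x y, x + y \notin L} ->
  (2 ^ \dim V < 3 * #|L|)%N ->
  exists f, ~~ [forall x in V, chi f x == 1] /\
    2 * \sum_(x in L) chi f x < 2 * #|L|%:R - (2 ^ \dim V)%:R.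
Proof.
move=> sLV sumL ltVL; set v := (2 ^ \dim V)%N in ltVL *; set l := #|L| in ltVL *.
pose s f := \sum_(x in L) chi f x; pose K f := [forall x in V, chi f x == 1].
have [/existsP[f /andP[]]|/existsPn noF] :=
    boolP [exists f, ~~ K f && (2 * s f < 2 * l%:R - v%:R)].
  by exists f.
have sK f : K f -> s f = l%:R.
  move=> /forall_inP Kf; rewrite /s (eq_bigr (fun=> 1)) ?sumr_const // => x /sLV xV.
  exact/eqP/Kf.
pose F f := 2 * s f ^+ 3 + (v%:R - 2 * l%:R) * s f ^+ 2.
have: 0 <= \sum_(f | ~~ K f) F f.
  apply: sumr_ge0 => f Kf; have := noF f; rewrite Kf /= -leNgt => sf.
  have -> : F f = s f ^+ 2 * (2 * s f - (2 * l%:R - v%:R)) by rewrite /F; ring.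
  by rewrite mulr_ge0 ?sqr_ge0 // subr_ge0.
have : \sum_f F f = (v%:R - 2 * l%:R) * (2 ^ m * l)%:R.
  by rewrite big_split /= -!mulr_sumr sum_chi_cube // sum_chi_square mulr0 add0r.
(* Each of the [k] characters trivial on [V] contributes [v * l ^ 2]; removing them from the total
   leaves [k * v * l * (v - 3 * l)], which is negative. *)
rewrite (bigID K) /= (eq_bigr (fun=> v%:R * l%:R ^+ 2)) => [|f Kf]; last first.
  by rewrite /F sK //; ring.
rewrite sumr_const; set k := #|_|.
have kv : (k * v = 2 ^ m)%N.
  by rewrite -(card_annihilator V); congr (_ * _)%N; apply: eq_card => f; rewrite !inE.
rewrite -kv -[_ *+ k]mulr_natr natrM natrM; set R := \sum_(f | _) _ => h1 R0.
have k0 : (0 < k)%N by have := expn_gt0 2 m; rewrite -kv muln_gt0 => /andP[].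
have v0 : (0 < v)%N by rewrite expn_gt0.
have: (v%:R * k%:R * l%:R) * (v%:R - 3 * l%:R) = R :> int.
  by rewrite -[R](addKr (v%:R * l%:R ^+ 2 * k%:R)) h1; ring.
have: 0 < v%:R * k%:R * l%:R :> int by rewrite !mulr_gt0 ?ltr0n //; lia.
have: v%:R - 3 * l%:R < 0 :> int by lia.
by move: R0; clear; nia.
Qed.

Lemma kernel_hyperplane (V : {vspace T}) f : ~~ [forall x in V, chi f x == 1] ->
  exists H : {vspace T},
    [/\ (H <= V)%VS, (\dim H).+1 = \dim V & {in V, forall x, (x \in H) = (chi f x == 1)}].
Proof.
rewrite negb_forall_in => /exists_inP[x0 x0V fx0].
pose g : 'Hom(T, 'cV['F_2]_1) := linfun (mulmx f \o trmx).
have gE x : (x \in lker g) = (chi f x == 1).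
  rewrite memv_ker lfunE /= /chi.
  rewrite -[LHS](inj_eq (@trmx_inj _ _ _)) trmx0 [_^T]mx11_scalar mxE.
  rewrite -scalemx1 scaler_eq0 oner_eq0 orbF.
  by case: eqP.
exists (V :&: lker g)%VS; split; first exact: capvSl; last first.
  by move=> x xV; rewrite memv_cap xV gE.
(* By rank-nullity it is enough that the image of [V] has dimension 1: it lies in a line and is
   nonzero, as [chi f x0] is not 1. *)
apply/eqP; rewrite -(limg_ker_dim g V) -addn1 eqn_add2l eq_sym eqn_leq.
have := dimvS (subvf (g @: V)%VS); rewrite dimvf dim_matrix => ->.
rewrite lt0n dimv_eq0 -lkerE; apply: contra fx0 => /subvP/(_ _ x0V).
by rewrite gE.
Qed.

(** [H] is the kernel in [V] of the biased character. The bias says that [L] fills more than half of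
    the complement of [H]; a point [x0] of [L] in [H] would give two disjoint copies [L1] and
    [x0 + L1] of that part, which do not fit. *)
Lemma sum_free_avoids_hyperplane (V : {vspace T}) (L : {set T}) :
  {subset L <= V} -> {in L &, forall x y, x + y \notin L} ->
  (2 ^ \dim V < 3 * #|L|)%N ->
  exists H : {vspace T},
    [/\ (H <= V)%VS, (\dim H).+1 = \dim V, {in L, forall x, x \notin H}
      & {in V &, forall x y, x \notin H -> y \notin H -> x + y \in H}].
Proof.
move=> sLV sumL ltVL.
have [f [/kernel_hyperplane[H [sHV dimH HE]] biasf]] :=
  sum_free_biased_character sLV sumL ltVL.
exists H; split=> //; last first.
  move=> x y xV yV; rewrite !HE ?memvD // chiD.
  by rewrite !chi_neq1 => /eqP-> /eqP->.
pose L1 := [set x in L | x \notin H].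
have cardL : #|L| = (#|L1| + #|[set x in L | x \in H]|)%N.
  rewrite -(cardsID [set x in H] L) addnC.
  by congr (_ + _)%N; apply: eq_card => x; rewrite !inE // andbC.
have sumLE : \sum_(x in L) chi f x = #|L|%:R - 2 * #|L1|%:R.
  rewrite (bigID (mem H)) /= (eq_bigr (fun=> 1)) => [|x /andP[/sLV xV]]; last first.
    by rewrite HE // => /eqP.
  rewrite [X in _ + X](eq_bigr (fun=> -1)) => [|x /andP[/sLV xV]]; last first.
    by rewrite HE // chi_neq1 => /eqP.
  rewrite !sumr_const cardL.
  have -> : #|[pred x in L | x \in H]| = #|[set x in L | x \in H]|.
    by apply: eq_card => x; rewrite !inE.
  have -> : #|[pred x in L | x \notin H]| = #|L1|.
    by apply: eq_card => x; rewrite !inE.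
  by rewrite mulNrn natrD; ring.
move=> x0 x0L; apply/negP => x0H.
pose L2 := [set x0 + x | x in L1].
have card1 : (#|L1 :|: L2| <= 2 ^ \dim H)%N.
  rewrite -(card_hyperplane_compl sHV dimH).
  apply/subset_leq_card/subsetP => x; rewrite !inE => /orP[/andP[/sLV -> ->] //|].
  case/imsetP => y; rewrite inE => /andP[yL yH] ->.
  by rewrite rpredDl ?yH ?rpredD ?sLV.
have dis : [disjoint L1 & L2].
  rewrite disjoint_subset; apply/subsetP => x; rewrite !inE => /andP[xL _].
  apply/imsetP => -[y]; rewrite inE => /andP[yL _] xE.
  by have := sumL _ _ x0L yL; rewrite -xE xL.
move: card1; rewrite cardsU disjoint_setI0 // cards0 subn0.
have -> : #|L2| = #|L1| by apply: card_imset; exact: addrI.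
move: biasf; rewrite sumLE -dimH expnS natrM; move: (2 ^ _)%N #|L| #|L1| => d l l1.
lia.
Qed.

End CharacterSums.

(** * Sumsets with subspaces, and blocking sets *)

Lemma vspace_split_line (F : fieldType) (T : vectType F) (V : {vspace T}) d :
  \dim V = d.+1 ->
  exists (W : {vspace T}) (u : T), [/\ V = (W + <[u]>)%VS, \dim W = d & u \notin W].
Proof.
move=> dimV; have sz : size (vbasis V) = d.+1 by rewrite size_tuple.
move: sz (vbasisP V); case: (tval (vbasis V)) => // u s [sz] bV.
have := basis_free bV; rewrite free_cons => /andP[us frs].
exists <<s>>%VS, u; split=> //; last by rewrite -sz; exact/eqP.
by rewrite -(span_basis bV) span_cons addvC.
Qed.

Section BlockingSets.
Variable m : nat.
Local Notation T := 'rV['F_2]_m.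

(** The union of the cosets of [W] that meet [X]. *)
Definition sumset (X : {set T}) (W : {vspace T}) : {set T} :=
  [set x + w | x in X, w in [set w in W]].

Lemma sumsetP (X : {set T}) (W : {vspace T}) y :
  reflect (exists2 w, w \in W & y + w \in X) (y \in sumset X W).
Proof.
apply: (iffP imset2P) => [[x w xX]|[w wW yX]].
  by rewrite inE => wW ->; exists w => //; rewrite -addrA addrr_F2 addr0.
by exists (y + w) w; rewrite ?inE // -addrA addrr_F2 addr0.
Qed.

Lemma card_sumset (X : {set T}) (W : {vspace T}) :
  (#|sumset X W| <= #|X| * 2 ^ \dim W)%N.
Proof.
rewrite -card_subspace_F2 -cardsX /sumset curry_imset2X; exact: leq_imset_card.
Qed.

Lemma sum_translate (V : {vspace T}) (g : T -> nat) t : t \in V ->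
  (\sum_(y in V) g (y + t)%R = \sum_(y in V) g y)%N.
Proof.
move=> tV; rewrite [RHS](reindex_inj (addIr t)) /=.
by apply: eq_bigl => y; rewrite rpredDr.
Qed.

(* Of [y], [y + u], [y + v] and [y + (u + v)] let [k >= 1] lie in [B]. Summed over these four
   points, the indicators of [D u], [D v] and [D (u + v)] total 6, 10, 12, 12 for k = 1, 2, 3, 4,
   hence at most [2 + 4 * k]. *)
Lemma translates_cover_count (V : {vspace T}) (B : {set T}) u v :
  let D (t : T) := [set y in V | (y \in B) || (y + t \in B)] in
  u \in V -> v \in V ->
  {in V, forall y, [|| y \in B, y + u \in B, y + v \in B | y + (u + v) \in B]} ->
  (2 * (#|D u| + #|D v| + #|D (u + v)%R|) <= 2 ^ \dim V + 8 * #|B|)%N.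
Proof.
move=> D uV vV cov; have uvV : u + v \in V by rewrite rpredD.
pose b (y : T) : nat := (y \in B); pose c (t y : T) : nat := (y \in B) || (y + t \in B).
pose g y := (c u y + c v y + c (u + v)%R y)%N.
have cardD t : (#|D t| = \sum_(y in V) c t y)%N.
  rewrite -sum1_card (eq_bigl (fun y => (y \in V) && ((y \in B) || (y + t \in B)))).
    by rewrite big_mkcondr /=; apply: eq_bigr => y _; rewrite /c; case: (_ || _).
  by move=> y; rewrite !inE.
have cardB : (\sum_(y in V) b y <= #|B|)%N.
  rewrite -sum1_card [X in (X <= _)%N](eq_bigr (fun y => if y \in B then 1 else 0)%N) => [|y _].
    rewrite -big_mkcondr /= big_mkcond [X in (_ <= X)%N]big_mkcond leq_sum // => y _.
    by case: (y \in V); case: (y \in B).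
  by rewrite /b; case: (y \in B).
have cardV : (\sum_(y in V) 1 = 2 ^ \dim V)%N.
  by rewrite -card_subspace_F2 -sum1_card; apply: eq_bigl => y; rewrite inE.
have : (\sum_(y in V) (g y + g (y + u)%R + g (y + v)%R + g (y + (u + v))%R) <=
        \sum_(y in V) (2 * 1 + 4 * (b y + b (y + u)%R + b (y + v)%R + b (y + (u + v))%R)))%N.
  apply: leq_sum => y /cov.
  (* These identities bring every translate back to one of the four points of the coset, leaving
     sixteen cases. *)
  have euu : y + u + u = y by rewrite -addrA addrr_F2 addr0.
  have evv : y + v + v = y by rewrite -addrA addrr_F2 addr0.
  have ew : y + (u + v) + (u + v) = y by rewrite -addrA addrr_F2 addr0.
  have euv : y + u + v = y + (u + v) by rewrite addrA.
  have evu : y + v + u = y + (u + v) by rewrite addrAC addrA.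
  have euw : y + u + (u + v) = y + v by rewrite addrA euu.
  have evw : y + v + (u + v) = y + u by rewrite (addrC u) addrA evv.
  have ewu : y + (u + v) + u = y + v by rewrite -evu -addrA addrr_F2 addr0.
  have ewv : y + (u + v) + v = y + u by rewrite -euv -addrA addrr_F2 addr0.
  rewrite /g /c /b euu evv ew euv evu euw evw ewu ewv.
  by case: (y \in B); case: (y + u \in B); case: (y + v \in B); case: (y + (u + v) \in B).
rewrite !big_split /= -big_distrr /= cardV.
rewrite !(sum_translate _ uV) !(sum_translate _ vV) !(sum_translate _ uvV) -!cardD big1_eq.
move: cardB; move: (\sum_(y in V) b y)%N #|D u| #|D v| #|D (u + v)%R| #|B| (2 ^ _)%N.
by clear; lia.
Qed.

(** The condition [x != 0] matters, since the sets [X] in use contain 0 and would otherwise meet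
    every subspace. *)
Definition blocks (X : {set T}) (n : nat) (V : {vspace T}) : Prop :=
  forall P : {vspace T}, (P <= V)%VS -> \dim P = n ->
    exists x, [/\ x \in X, x != 0 & x \in P].

Lemma blocks_sub (X : {set T}) n (V H : {vspace T}) :
  (H <= V)%VS -> blocks X n V -> blocks X n H.
Proof. by move=> sHV bV P sPH; apply: bV; apply: subv_trans sHV. Qed.

Lemma blocks_or_avoids (X : {set T}) n (V : {vspace T}) :
  blocks X n V \/
  exists U : {vspace T}, [/\ (U <= V)%VS, \dim U = n & {in X, forall x, x \in U -> x = 0}].
Proof.
case: (classic (exists U : {vspace T},
  [/\ (U <= V)%VS, \dim U = n & {in X, forall x, x \in U -> x = 0}])) => [?|noU].
  by right.
left=> P sPV dimP.
have [/exists_inP[x xX /andP[x0 xP]]|/exists_inPn hP] :=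
    boolP [exists x in X, (x != 0) && (x \in P)].
  by exists x.
case: noU; exists P; split=> // x xX xP; apply/eqP.
by have := hP x xX; rewrite xP andbT negbK.
Qed.

(** The subspace spanned by [U] and [y] has dimension [n.+1], so it has a nonzero point in [X]; that
    point is not in [U], hence is in [y + U]. *)
Lemma blocks_coset (X : {set T}) n (V U : {vspace T}) y :
  blocks X n.+1 V -> (U <= V)%VS -> \dim U = n -> {in X, forall x, x \in U -> x = 0} ->
  y \in V -> y \notin U -> exists2 x, x \in X & x + y \in U.
Proof.
move=> bV sUV dimU avU yV yU.
have [||x [xX x0]] := bV (U + <[y]>)%VS.
- by rewrite subv_add sUV -memvE.
- by rewrite dim_add_line ?dimU.
rewrite memv_add_line_F2 => /orP[xU|]; last by exists x.
by rewrite (avU x xX xU) eqxx in x0.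
Qed.

(** * Descent to a hyperplane, with [p.+3] as the blocked dimension *)

Section Hyperplane.
Variables (V : {vspace T}) (X : {set T}) (p : nat).
Hypothesis X0 : 0 \in X.
Hypothesis XV : blocks X p.+3 V.
Hypothesis cardX : (#|X| * 2 ^ p.+3 < 3 * 2 ^ \dim V)%N.

(** If [x], [y] and [x + y] all missed [X + Q], then [Q + <[x]>] would avoid [X] outside 0, so its
    coset through [y] would meet [X]; but that coset is the union of [y + Q] and [x + y + Q]. *)
Lemma sum_free_gap (Q : {vspace T}) : (Q <= V)%VS -> \dim Q = p.+1 ->
  {in X, forall x, x \in Q -> x = 0} ->
  {in [set y in V | y \notin sumset X Q] &, forall x y,
     x + y \notin [set y in V | y \notin sumset X Q]}.
Proof.
move=> sQV dimQ avQ x y; rewrite !inE => /andP[xV xL] /andP[yV yL].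
apply/negP => /andP[_ xyL].
(* As 0 is in [X], all of [Q] lies in [X + Q]. *)
have notQ z : z \notin sumset X Q -> z \notin Q.
  by apply: contra => zQ; apply/sumsetP; exists z; rewrite ?addrr_F2.
have xQ := notQ x xL; have yQ := notQ y yL; have xyQ := notQ _ xyL.
have yQx : y \notin (Q + <[x]>)%VS by rewrite memv_add_line_F2 (negPf yQ) addrC.
have [|||z zX] := blocks_coset XV _ _ _ yV yQx.
- by rewrite subv_add sQV -memvE.
- by rewrite dim_add_line ?dimQ.
- move=> z zX; rewrite memv_add_line_F2 => /orP[/(avQ z zX) //|zx].
  by case/negP: xL; apply/sumsetP; exists (z + x) => //; rewrite addrC -addrA addrr_F2 addr0.
rewrite memv_add_line_F2 => /orP[zy|zyx].
  by case/negP: yL; apply/sumsetP; exists (z + y) => //; rewrite addrC -addrA addrr_F2 addr0.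
case/negP: xyL; apply/sumsetP; exists (z + y + x) => //.
by rewrite -[z + y + x]addrA [y + x]addrC addrCA addrr_F2 addr0.
Qed.

Lemma blocking_hyperplane_of_gap (Q : {vspace T}) : (Q <= V)%VS -> \dim Q = p.+1 ->
  {in X, forall x, x \in Q -> x = 0} ->
  (2 ^ \dim V < 3 * #|[set y in V | y \notin sumset X Q]|)%N ->
  exists H : {vspace T}, [/\ (H <= V)%VS, (\dim H).+1 = \dim V & blocks X p.+2 H].
Proof.
move=> sQV dimQ avQ; have sfL := sum_free_gap sQV dimQ avQ; move: sfL.
set L := [set y in V | _] => sfL ltL.
have sLV : {subset L <= V} by move=> y; rewrite inE => /andP[].
have [H [sHV dimH LH VH]] := sum_free_avoids_hyperplane sLV sfL ltL.
(* [L] is a union of cosets of [Q] and lies outside [H], where any two points of [V] differ by an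
   element of [H]. *)
have sQH : (Q <= H)%VS.
  have /card_gt0P[y yL] : (0 < #|L|)%N by lia.
  apply/subvP => q qQ; have yqL : y + q \in L.
    move: yL; rewrite !inE => /andP[yV yXQ]; rewrite rpredD ?(subvP sQV q qQ) //=.
    apply: contra yXQ => /sumsetP[w wQ yX].
    by apply/sumsetP; exists (q + w); rewrite ?rpredD ?addrA.
  by rewrite -(addKr_F2 y q); apply: VH; rewrite ?sLV ?LH.
exists H; split=> //.
case: (blocks_or_avoids X p.+2 H) => // -[U [sUH dimU avU]]; exfalso.
have sUV := subv_trans sUH sHV.
(* Each coset of [U] in [V] outside [H] needs its own point of [X] outside [H]. *)
have out : (2 ^ \dim H <= #|X :\: [set x in H]| * 2 ^ p.+2)%N.
  rewrite -(card_hyperplane_compl sHV dimH) -dimU.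
  apply: leq_trans (card_sumset _ _); apply/subset_leq_card/subsetP => y.
  rewrite !inE => /andP[yH yV].
  have yU : y \notin U by apply: contra yH => /(subvP sUH).
  have [x xX xyU] := blocks_coset XV sUV dimU avU yV yU.
  apply/sumsetP; exists (x + y) => //.
  rewrite addrC -addrA addrr_F2 addr0 !inE xX andbT; apply: contra yH => xH.
  by rewrite -(addKr_F2 x y) rpredD // (subvP sUH).
(* [L] misses [H], so each coset of [Q] in [H] contains a point of [X]. Together with [out] this
   gives at least [3 * 2 ^ \dim H / 2 ^ p.+2] points, against [cardX]. *)
have ins : (2 ^ \dim H <= #|X :&: [set x in H]| * 2 ^ p.+1)%N.
  rewrite -{1}card_subspace_F2 -dimQ; apply: leq_trans (card_sumset _ _).
  apply/subset_leq_card/subsetP => y; rewrite inE => yH; have yV := subvP sHV _ yH.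
  have : y \notin L by apply: contraL yH => /LH.
  rewrite inE yV negbK => /sumsetP[q qQ yX]; apply/sumsetP; exists q => //.
  by rewrite !inE yX rpredD // (subvP sQH).
move: cardX; rewrite -(cardsID [set x in H] X) -dimH; move: out ins.
rewrite !expnS; move: #|X :\: _| #|X :&: _| (2 ^ p)%N (2 ^ _)%N => a b c d; lia.
Qed.

Lemma blocking_hyperplane : (p.+3 <= \dim V)%N ->
  exists H : {vspace T}, [/\ (H <= V)%VS, (\dim H).+1 = \dim V & blocks X p.+2 H].
Proof.
move=> ltpV.
case: (blocks_or_avoids X p.+2 V) => [bV|[U [sUV dimU avU]]].
  have [|H [u [defV dimH _]]] := @vspace_split_line _ _ V (\dim V).-1.
    by rewrite prednK //; lia.
  have sHV : (H <= V)%VS by rewrite defV addvSl.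
  by exists H; split=> //; [rewrite dimH prednK //; lia | apply: blocks_sub bV].
(* Now [U] is the sum of [W], of dimension [p], and the lines of [u] and [v]; the spaces between are
   [W + <[t]>] for [t] equal to [u], [v] or [u + v]. *)
have [W1 [v [defU dimW1 vW1]]] := vspace_split_line dimU.
have [W [u [defW1 dimW uW]]] := vspace_split_line dimW1.
have sW1U : (W1 <= U)%VS by rewrite defU addvSl.
have sWW1 : (W <= W1)%VS by rewrite defW1 addvSl.
have uW1 : u \in W1 by rewrite defW1 memvE addvSr.
have uU : u \in U := subvP sW1U _ uW1.
have vU : v \in U by rewrite defU memvE addvSr.
have vW : v \notin W by apply: contra vW1 => /(subvP sWW1).
have uvW : u + v \notin W.
  by apply: contra vW1 => uvW; rewrite -(addKr_F2 u v) rpredD // (subvP sWW1).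
have sUVp := subvP sUV.
(* Every coset of [U] meets [X] ([U] itself in 0), hence so does one of the four cosets of [W] that
   compose it. *)
have cov : {in V, forall y, [|| y \in sumset X W, y + u \in sumset X W,
    y + v \in sumset X W | y + (u + v) \in sumset X W]}.
  move=> y yV; have [w wU yX] : exists2 w, w \in U & y + w \in X.
    have [yU|yU] := boolP (y \in U); first by exists y => //; rewrite addrr_F2.
    have [x xX xyU] := blocks_coset XV sUV dimU avU yV yU.
    by exists (x + y) => //; rewrite addrC -addrA addrr_F2 addr0.
  have shift t : w + t \in W -> y + t \in sumset X W.
    by move=> wt; apply/sumsetP; exists (w + t) => //; rewrite addrACA addrr_F2 addr0.
  move: wU; rewrite defU memv_add_line_F2 defW1 !memv_add_line_F2 -!orbA.
  case/or4P => wW; last first.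
  - by rewrite [y + (u + v) \in _]shift ?orbT // [u + v]addrC addrA.
  - by rewrite [y + v \in _]shift ?orbT.
  - by rewrite [y + u \in _]shift ?orbT.
  - by have := @shift 0; rewrite !addr0 => ->.
pose D (t : T) := [set y in V | (y \in sumset X W) || (y + t \in sumset X W)].
have hD : (2 * (#|D u| + #|D v| + #|D (u + v)%R|) <= 2 ^ \dim V + 8 * #|sumset X W|)%N.
  exact: translates_cover_count (sUVp _ uU) (sUVp _ vU) cov.
have := card_sumset X W; rewrite dimW; move: cardX hD; rewrite !expnS.
(* Within [V], [D t] is the sumset of [X] with [W + <[t]>], so a small [D t] is a large gap. *)
have finish t : t \in U -> t \notin W -> (3 * #|D t| < 2 * 2 ^ \dim V)%N ->
    exists H : {vspace T}, [/\ (H <= V)%VS, (\dim H).+1 = \dim V & blocks X p.+2 H].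
  move=> tU tW ltD; have sQU : (W + <[t]> <= U)%VS.
    by rewrite subv_add (subv_trans sWW1) // -memvE.
  apply: (@blocking_hyperplane_of_gap (W + <[t]>)%VS).
  - exact: subv_trans sUV.
  - by rewrite dim_add_line ?dimW.
  - by move=> x xX /(subvP sQU); apply: avU.
  have <- : [set y in V] :\: D t = [set y in V | y \notin sumset X (W + <[t]>)%VS].
    apply/setP => y; rewrite !inE; case yV : (y \in V) => //=; rewrite andbT.
    congr (~~ _); apply/orP/sumsetP => [[]/sumsetP[w wW yX]|[w]].
    - by exists w => //; rewrite memv_add_line_F2 wW.
    - by exists (t + w); rewrite ?addrA // memv_add_line_F2 addrAC addrr_F2 add0r wW orbT.
    rewrite memv_add_line_F2 => /orP[wW|wW] yX; first by left; apply/sumsetP; exists w.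
    by right; apply/sumsetP; exists (w + t); rewrite // addrACA addrr_F2 addr0.
  rewrite cardsD (setIidPr _) ?card_subspace_F2; last first.
    by apply/subsetP => y; rewrite !inE => /andP[].
  by move: ltD; move: (2 ^ _)%N #|D t| => a b; clear; lia.
move=> hX hD hB.
(* If all three sets had at least two thirds of [V], then [hD] would force [8 * #|sumset X W|] to be
   at least [3 * 2 ^ \dim V], whereas [card_sumset] and [cardX] put it below. *)
have [/finish|hu] := ltnP (3 * #|D u|) (2 * 2 ^ \dim V); first exact.
have [/finish|hv] := ltnP (3 * #|D v|) (2 * 2 ^ \dim V); first exact.
apply: (finish (u + v) _ uvW); first exact: rpredD.
move: hX hD hB hu hv; move: #|X| #|sumset X W| (2 ^ p)%N #|D u| #|D v| #|D (u + v)|.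
move: (2 ^ _)%N; clear; lia.
Qed.

End Hyperplane.

(** Passing to a hyperplane lowers both exponents by one, so the size bound persists with the same
    [X]. *)
Lemma blocking_flag (V : {vspace T}) (X : {set T}) n :
  0 \in X -> blocks X n.+2 V -> (#|X| * 2 ^ n.+2 < 3 * 2 ^ \dim V)%N ->
  (n.+2 <= \dim V)%N ->
  exists W : {vspace T}, [/\ (W <= V)%VS, (\dim W + n)%N = \dim V & blocks X 2 W].
Proof.
move=> X0; elim: n V => [|n IHn] V bV cardX dimV.
  by exists V; rewrite addn0 subvv.
have [H [sHV dimH bH]] := blocking_hyperplane X0 bV cardX dimV.
have [|| W [sWH dimW bW]] := IHn H bH.
- by move: cardX; rewrite -dimH !expnS; lia.
- by rewrite -ltnS dimH.
by exists W; split=> //; [apply: subv_trans sHV | rewrite addnS dimW].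
Qed.

End BlockingSets.

(** * Linear algebra of represented matroids *)

Lemma perm_enum_imset (aT rT : finType) (f : aT -> rT) (A : {set aT}) :
  injective f -> perm_eq (enum (f @: A)) (map f (enum A)).
Proof.
move=> injf; apply: uniq_perm; rewrite ?map_inj_uniq ?enum_uniq // => y.
rewrite mem_enum; apply/imsetP/mapP => -[x xA ->]; exists x => //.
  by rewrite mem_enum.
by rewrite mem_enum in xA.
Qed.

Lemma free_map_inj_on (F : fieldType) (T1 T2 : vectType F) (P : {vspace T1})
    (g : 'Hom(T1, T2)) (s : seq T1) :
  (P :&: lker g = 0)%VS -> {subset s <= P} -> free (map g s) = free s.
Proof.
move=> Pg sP; rewrite /free size_map -limg_span limg_dim_eq //.
apply/eqP; rewrite -subv0 -Pg capvS //; exact/span_subvP.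
Qed.

(** Coordinates in a basis of [P], as a linear map on all of [T] that is injective on [P]. *)
Lemma coordinates_exist (F : fieldType) (T : vectType F) (P : {vspace T}) n :
  \dim P = n -> exists g : 'Hom(T, 'rV[F]_n), (P :&: lker g = 0)%VS.
Proof.
move=> <-; pose g0 (x : T) : 'rV[F]_(\dim P) := \row_i coord (vbasis P) i x.
have lin_g0 : linear g0.
  by move=> a x y; apply/rowP => i; rewrite !mxE linearP.
pose L := GRing.isLinear.Build _ _ _ _ g0 lin_g0.
pose gL : {linear T -> 'rV[F]_(\dim P)} := HB.pack g0 L.
exists (linfun gL); apply/eqP; rewrite -subv0; apply/subvP => x.
rewrite memv_cap memv_ker lfunE /= memv0 => /andP[xP /eqP/rowP gx].
rewrite (coord_vbasis xP) big1 // => i _.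
by have := gx i; rewrite !mxE => ->; rewrite scale0r.
Qed.

Lemma free2_F2 (T : vectType 'F_2) (x y : T) :
  free [:: x; y] = [&& x != 0, y != 0 & x != y].
Proof.
rewrite free_cons span_seq1 seq1_free -[<[y]>%VS]add0v memv_add_line_F2 !memv0.
by rewrite addr_eq0 oppr_F2 negb_or -andbA [(x != y) && _]andbC.
Qed.

Lemma mem_span2_F2 (T : vectType 'F_2) (x y z : T) :
  (z \in <<[:: x; y]>>%VS) = [|| z == 0, z == x, z == y | z == x + y].
Proof.
rewrite span_cons span_seq1 -[(<[x]> + _)%VS]add0v addvA !memv_add_line_F2 !memv0.
by rewrite !addr_eq0 !oppr_F2 -!orbA -[y in z + y]oppr_F2 subr_eq.
Qed.

Section Representation.
Variables (F : fieldType) (E : finType) (T : vectType F) (M : matroid E) (phi : E -> T).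

Definition represents : Prop := forall A, indep M A = free [seq phi x | x <- enum A].

Definition vspan (A : {set E}) : {vspace T} := <<[seq phi x | x <- enum A]>>%VS.

Lemma mem_vspan (A : {set E}) x : x \in A -> phi x \in vspan A.
Proof. by move=> xA; apply/memv_span/map_f; rewrite mem_enum. Qed.

Lemma vspan_subP (A : {set E}) (W : {vspace T}) :
  reflect {in A, forall x, phi x \in W} (vspan A <= W)%VS.
Proof.
apply: (iffP span_subvP) => [sAW x xA|sAW _ /mapP[x xA ->]].
  by apply/sAW/map_f; rewrite mem_enum.
by apply: sAW; rewrite mem_enum in xA.
Qed.

Lemma vspanS (A B : {set E}) : A \subset B -> (vspan A <= vspan B)%VS.
Proof. by move=> sAB; apply/vspan_subP => x xA; apply/mem_vspan/(subsetP sAB). Qed.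

Hypothesis Mphi : represents.

Lemma indep_seq (s : seq E) : uniq s -> indep M [set:: s] = free (map phi s).
Proof.
move=> us; rewrite Mphi; apply/perm_free/perm_map/uniq_perm; rewrite ?enum_uniq //.
by move=> x; rewrite mem_enum inE.
Qed.

Lemma indepU1 (A : {set E}) x : indep M A -> phi x \notin vspan A -> indep M (x |: A).
Proof.
rewrite !Mphi => frA xA; have xNA : x \notin A by apply: contra xA; exact: mem_vspan.
have perA : perm_eq (enum (x |: A)) (x :: enum A).
  apply: uniq_perm; rewrite /= ?enum_uniq ?mem_enum ?xNA //.
  by move=> y; rewrite !inE !mem_enum !inE.
by rewrite (perm_free (perm_map phi perA)) /= free_cons frA andbT.
Qed.

(** A largest independent subset of [A] spans [vspan A], since a vector outside its span would
    extend it. *)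
Lemma rank_vspan (A : {set E}) : rank M A = \dim (vspan A).
Proof.
have card_dim B : indep M B -> #|B| = \dim (vspan B).
  by rewrite Mphi /free => /eqP ->; rewrite size_map -cardE.
apply/eqP; rewrite eqn_leq; apply/andP; split.
  apply/bigmax_leqP => B /andP[sBA /card_dim->]; exact/dimvS/vspanS.
pose P (B : {set E}) := (B \subset A) && indep M B.
have P0 : P set0 by rewrite /P sub0set indep_set0.
case: (arg_maxnP (fun B : {set E} => #|B|) P0) => B /andP[sBA iB] maxB.
apply: leq_trans (@leq_bigmax_cond _ _ (fun C : {set E} => #|C|) B _); last by rewrite sBA.
rewrite card_dim //; apply/dimvS/vspan_subP => x xA.
apply/negPn/negP => xB; have xNB : x \notin B by apply: contra xB; exact: mem_vspan.
have := maxB (x |: B).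
rewrite /P subUset sub1set xA sBA indepU1 // cardsU1 => /(_ isT).
by rewrite xNB; lia.
Qed.

Lemma represents_restrict (K : {set E}) (A : {set {x | x \in K}}) :
  indep (restrict M K) A = free [seq phi (val x) | x <- enum A].
Proof.
rewrite [LHS]Mphi -[RHS]/(free (map (phi \o val) (enum A))) map_comp.
apply/perm_free/perm_map/perm_enum_imset; exact: val_inj.
Qed.

Lemma simple_nonzero : simple M -> forall e, phi e != 0.
Proof.
case=> noloop _ e; have := noloop e; rewrite /loop negbK -seq1_free => ie.
rewrite -(@indep_seq [:: e]) // -(_ : [set e] = [set:: [:: e]]) //.
by apply/setP => x; rewrite !inE.
Qed.

Lemma simple_injective : simple M -> injective phi.
Proof.
case=> noloop nopar e f ef; apply/eqP/negPn/negP => nef.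
have := nopar e f; rewrite /parallel nef !noloop negbK Mphi => /free_uniq.
move/dinjectiveP => inj_ef; case/eqP: nef; apply: inj_ef; rewrite ?inE ?eqxx ?orbT //.
Qed.

End Representation.

(** * Projective restrictions, triangles, and spans of sum-free sets *)

Lemma PG2_restriction_of_subspace (E : finType) (M : matroid E) (m d : nat)
    (phi : E -> 'rV['F_2]_m) (P : {vspace 'rV['F_2]_m}) :
  represents M phi -> simple M -> \dim P = d.+1 ->
  (forall x, x \in P -> x != 0 -> exists e, phi e = x) ->
  exists X : {set E}, isomorphic (restrict M X) (PG2 d).
Proof.
move=> Mphi Msimple dimP PS.
have phi0 := simple_nonzero Mphi Msimple; have injphi := simple_injective Mphi Msimple.
have [g gP] := coordinates_exist dimP.
have gI x : x \in P -> g x = 0 -> x = 0.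
  by move=> xP gx; apply/eqP; rewrite -memv0 -gP memv_cap xP memv_ker gx eqxx.
pose X := [set e | phi e \in P]; exists X.
have gX (e : {e | e \in X}) : g (phi (val e)) != 0.
  have := valP e; rewrite inE => eP; apply: contraNneq (phi0 (val e)) => /(gI _ eP) ->.
  by rewrite eqxx.
pose f (e : {e | e \in X}) : {v : 'rV['F_2]_d.+1 | v != 0} := exist _ (g (phi (val e))) (gX e).
have injf : injective f.
  move=> e1 e2 /(congr1 val) /= /eqP; rewrite -subr_eq0 -linearB /= => /eqP g12.
  have := valP e1; have := valP e2; rewrite !inE => e2P e1P.
  apply/val_inj/injphi/eqP; rewrite -subr_eq0; apply/eqP/gI => //.
  by rewrite rpredB.
exists f; split.
  (* Both sides have [2 ^ d.+1 - 1] elements. *)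
  apply: inj_card_bij injf _; rewrite !card_sig.
  have -> : #|[pred e | e \in X]| = #|[set x in P]| .-1.
    rewrite (cardsD1 0) inE mem0v /=.
    rewrite -(card_imset (mem X) injphi); apply: eq_card => x; rewrite !inE.
    apply/imsetP/andP => [[e]|[x0 xP]]; first by rewrite inE => eP ->; rewrite phi0.
    by have [e eE] := PS x xP x0; exists e; rewrite ?inE eE.
  rewrite card_subspace_F2 dimP.
  have -> : #|[pred v : 'rV['F_2]_d.+1 | v != 0]| = #|[set~ (0 : 'rV['F_2]_d.+1)]|.
    by apply: eq_card => v; rewrite !inE.
  by rewrite cardsC1 card_mx card_Fp // mul1n.
move=> A; rewrite (represents_restrict Mphi) /= /vector_indep.
rewrite (perm_free (perm_map _ (perm_enum_imset _ injf))) -map_comp.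
rewrite (map_comp g (fun e : {e | e \in X} => phi (val e))).
apply: (free_map_inj_on gP) => _ /mapP[e _ ->].
by have := valP e; rewrite inE.
Qed.

(** The points [a], [b] and [c], with [c] the sum of the other two, are pairwise independent but
    jointly dependent. Pulled back by [h], they give three distinct nonzero vectors with one in the
    span of the other two, hence equal to their sum. *)
Lemma triangle_free_of_sum_free (E : finType) (N : matroid E) (m : nat)
    (phi : E -> 'rV['F_2]_m) :
  represents N phi -> (forall x y z : E, phi x + phi y != phi z) -> triangle_free N.
Proof.
move=> Nphi sumN [X [f [[h fK hK] fI]]].
pose psi (e : {e | e \in X}) := phi (val e).
have Npsi : represents (restrict N X) psi by move=> A; exact: represents_restrict.
have PGval : represents (PG2 1) val by [].
have injh := can_inj hK.
have indh s : uniq s -> free (map psi (map h s)) = free (map val s).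
  move=> us; rewrite -(indep_seq Npsi) ?map_inj_uniq // -fI -(indep_seq PGval) //.
  congr (indep _ _); apply/setP => v; rewrite inE; apply/imsetP/idP => [[e]|vs].
    by rewrite inE => /mapP[w ws ->] ->; rewrite hK.
  by exists (h v); rewrite ?hK // inE map_f.
pose a0 : 'rV['F_2]_2 := delta_mx 0 0; pose b0 : 'rV['F_2]_2 := delta_mx 0 1.
have a0n : a0 != 0 by apply/rV0Pn; exists 0; rewrite mxE.
have b0n : b0 != 0 by apply/rV0Pn; exists 1; rewrite mxE.
have ab0 : a0 != b0 by apply/eqP => /rowP/(_ 0); rewrite !mxE.
have c0n : a0 + b0 != 0 by rewrite addr_eq0 oppr_F2.
pose a : {v : 'rV['F_2]_2 | v != 0} := exist _ a0 a0n.
pose b : {v : 'rV['F_2]_2 | v != 0} := exist _ b0 b0n.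
pose c : {v : 'rV['F_2]_2 | v != 0} := exist _ (a0 + b0) c0n.
have ca : a0 + b0 != a0 by rewrite -subr_eq0 addrAC subrr add0r.
have cb : a0 + b0 != b0 by rewrite -subr_eq0 addrK.
have cna : c != a by rewrite -val_eqE.
have cnb : c != b by rewrite -val_eqE.
have anb : a != b by rewrite -val_eqE.
have : free (map psi (map h [:: a; b])).
  by rewrite indh /= ?inE ?anb // free2_F2 a0n b0n.
rewrite free2_F2 => /and3P[x0 y0 xy].
have : free (map psi (map h [:: c; a])).
  by rewrite indh /= ?inE ?cna // free2_F2 c0n a0n.
rewrite free2_F2 => /and3P[z0 _ zx].
have : free (map psi (map h [:: c; b])).
  by rewrite indh /= ?inE ?cnb // free2_F2 c0n b0n.
rewrite free2_F2 => /and3P[_ _ zy].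
have := indh [:: c; a; b]; rewrite /= !inE (negPf cna) (negPf cnb) anb => /(_ isT).
rewrite [RHS]free_cons mem_span2_F2 eqxx !orbT /= free_cons free2_F2 x0 y0 xy andbT.
by rewrite mem_span2_F2 (negPf z0) (negPf zx) (negPf zy) eq_sym (negPf (sumN _ _ _)).
Qed.

(** For [x0] in [S], the translate [x0 + S] is disjoint from [S]. *)
Lemma card_sum_free_bound (m : nat) (V : {vspace 'rV['F_2]_m}) (S : {set 'rV['F_2]_m}) :
  {subset S <= V} -> {in S &, forall x y, x + y \notin S} -> (2 * #|S| <= 2 ^ \dim V)%N.
Proof.
move=> sSV sfS; have [->|/set0Pn[x0 x0S]] := eqVneq S set0; first by rewrite cards0.
pose S' := [set x0 + x | x in S].
have cS' : #|S'| = #|S| by apply: card_imset; exact: addrI.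
have dis : [disjoint S & S'].
  rewrite disjoint_subset; apply/subsetP => x xS; rewrite !inE.
  by apply/imsetP => -[y yS xE]; have := sfS _ _ x0S yS; rewrite -xE xS.
rewrite mul2n -addnn -{2}cS' -card_subspace_F2.
have -> : (#|S| + #|S'| = #|S :|: S'|)%N by rewrite cardsU disjoint_setI0 // cards0 subn0.
apply/subset_leq_card/subsetP => x; rewrite !inE => /orP[/sSV //|/imsetP[y yS ->]].
by rewrite rpredD ?sSV.
Qed.

(** A proper subspace has at most half of [W], and a sum-free set at most half of that subspace. *)
Lemma dense_sum_free_span (m : nat) (D W : {vspace 'rV['F_2]_m}) (S : {set 'rV['F_2]_m}) :
  (D <= W)%VS -> {subset S <= D} -> {in S &, forall x y, x + y \notin S} ->
  (2 ^ \dim W < 4 * #|S|)%N -> D = W.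
Proof.
move=> sDW sSD sfS ltWS; apply/eqP; rewrite eqEdim sDW leqNgt; apply/negP => ltDW.
have := card_sum_free_bound sSD sfS.
have := leq_exp2l (\dim D).+1 (\dim W) (isT : 1 < 2)%N; rewrite ltDW expnS.
by move: ltWS; move: #|S| (2 ^ _)%N (2 ^ _)%N; clear; lia.
Qed.

(** * Construction of the flat *)

Theorem theorem1p1 (r n : nat) (E : finType) (M : matroid E)
    (hn : (2 <= n)%N) (hr : (n <= r)%N)
    (M_simple : simple M) (M_binary : binary M) (M_rank : matroid_rank M = r)
    (M_free : matroid_free (PG2 n.-1) M)
    (M_size : (1 - 3 / 2 ^+ n) * 2 ^+ r < #|E|%:R :> rat) :
  exists K : {set E},
    [/\ flat M K,
        corank M K = (n - 2)%N,
        triangle_free (restrict M K)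
      & 4^-1 * 2 ^+ rank M K < #|K|%:R :> rat].
Proof.
have [m [phi Mphi]] := M_binary; change (represents M phi) in Mphi.
have phi0 := simple_nonzero Mphi M_simple; have injphi := simple_injective Mphi M_simple.
have [p np] : exists p, n = p.+2 by exists n.-2; lia.
subst n.
pose V := vspan phi [set: E]; have dimV : \dim V = r by rewrite -(rank_vspan Mphi).
pose S := phi @: [set: E]; have cardS : #|S| = #|E| by rewrite card_imset ?cardsT.
have memS e : phi e \in S by apply: imset_f; rewrite inE.
have sSV : S \subset [set x in V].
  by apply/subsetP => _ /imsetP[e eE ->]; rewrite inE mem_vspan.
pose X := [set x in V] :\: S.
have X0 : 0 \in X.
  rewrite !inE mem0v andbT; apply/imsetP => -[e _ /esym/eqP].
  by rewrite (negPf (phi0 e)).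
have cardX : (#|X| * 2 ^ p.+2 < 3 * 2 ^ \dim V)%N.
  have : (2 ^ r * 2 ^ p.+2 < #|E| * 2 ^ p.+2 + 3 * 2 ^ r)%N.
    move: M_size (expn_gt0 2 p.+2); rewrite -!natrX /=.
    move: (2 ^ p.+2)%N (2 ^ r)%N #|E| => q R e h q0.
    have q0' : 0 < q%:R :> rat by rewrite ltr0n.
    move: h; rewrite -(ltr_pM2r q0') -(ltr_nat rat) natrD !natrM.
    rewrite (_ : _ * q%:R = R%:R * q%:R - 3 * R%:R) ?ltrBlDr //.
    by field; rewrite gt_eqF.
  rewrite cardsD (setIidPr sSV) card_subspace_F2 cardS dimV mulnBl.
  by move: (expn_gt0 2 r); move: (2 ^ p.+2)%N (2 ^ r)%N #|E|; clear; lia.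
(* A subspace avoiding [X] outside 0 has all its nonzero vectors in [S], which yields the forbidden
   projective geometry. *)
have bV : blocks X p.+2 V.
  case: (blocks_or_avoids X p.+2 V) => // -[P [sPV dimP avP]]; case: M_free.
  apply: (PG2_restriction_of_subspace Mphi M_simple dimP) => x xP x0.
  have : x \notin X by apply: contra x0 => xX; rewrite (avP x).
  by rewrite !inE (subvP sPV) // andbT negbK => /imsetP[e _ ->]; exists e.
have [|W [sWV dimW bW]] := blocking_flag X0 bV cardX; first by rewrite dimV.
pose K := [set e | phi e \in W]; exists K.
have sumK e1 e2 e3 : e1 \in K -> e2 \in K -> phi e1 + phi e2 != phi e3.
  rewrite !inE => W1 W2; apply/eqP => e12.
  have n12 : phi e2 \notin <[phi e1]>%VS.
    rewrite -[<[_]>%VS]add0v memv_add_line_F2 !memv0 (negPf (phi0 _)) /=.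
    by rewrite addrC e12 phi0.
  (* The only nonzero vectors of this plane are those of [e1], [e2] and their sum; if the sum were
     also in [S], none could be in [X]. *)
  have [||x [xX x0]] := bW (<[phi e1]> + <[phi e2]>)%VS.
  - by rewrite subv_add -!memvE W1 W2.
  - by rewrite dim_add_line // dim_vline phi0.
  rewrite -(span_seq1 (phi e2)) -span_cons mem_span2_F2 (negPf x0) e12 /=.
  by case/or3P => /eqP xE; move: xX; rewrite !inE xE memS.
(* [W] is covered by the image of [K] and [X], and [cardX] bounds [X] by less than three quarters of
   [W]. *)
have cardK : (2 ^ \dim W < 4 * #|K|)%N.
  have : (#|[set x in W]| <= #|phi @: K :|: X|)%N.
    apply/subset_leq_card/subsetP => x; rewrite !inE => xW; rewrite (subvP sWV) // andbT orbC.
    have [/imsetP[e _ xE]|//] := boolP (x \in S).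
    by rewrite xE imset_f // inE -xE.
  rewrite card_subspace_F2 => /leq_trans/(_ (leq_card_setU _ _)).
  rewrite card_imset //; move: cardX; rewrite -dimW expnD !expnS.
  have := expn_gt0 2 p; move: #|X| #|K| (2 ^ p)%N (2 ^ _)%N => a b c d.
  by clear; nia.
(* Density makes [K] span [W], so the rank of [K] is [\dim W] and its closure adds nothing. *)
have spanK : vspan phi K = W.
  apply: (@dense_sum_free_span _ _ _ (phi @: K)); rewrite ?card_imset //.
  - by apply/vspan_subP => e; rewrite inE.
  - by move=> _ /imsetP[e eK ->]; rewrite mem_vspan.
  move=> _ _ /imsetP[e1 K1 ->] /imsetP[e2 K2 ->]; apply/imsetP => -[e3 _ /eqP].
  exact/negP/sumK.
have rankK : rank M K = \dim W by rewrite (rank_vspan Mphi) spanK.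
split.
- apply/eqP/setP => e; rewrite !inE !(rank_vspan Mphi).
  apply/idP/idP => [dimE|eW].
    rewrite -spanK (_ : vspan phi K = vspan phi (e |: K)) ?mem_vspan ?setU11 //.
    by apply/eqP; rewrite eqEdim vspanS ?subsetUr // (eqP dimE) leqnn.
  by rewrite (setUidPr _) // sub1set inE.
- by rewrite /corank M_rank rankK -dimV -dimW addKn subn2.
- apply: (triangle_free_of_sum_free (phi := fun e => phi (val e))).
    exact: represents_restrict.
  by move=> x y z; apply: sumK; exact: valP.
rewrite rankK ltr_pdivrMl // -natrX -natrM ltr_nat; exact: cardK.
Qed.
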